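(* Let $u=\prod_{i=1}^{\infty} ab^i=ababbabbb\cdots\in\{a,b\}^{\mathbb{N}}$. Then $p_u(n)=\Theta(n^2)$ and $4\leq d_0(u)\leq 6$.
   Context: For a language $L$ (a set of finite words over a finite alphabet), $p_L(n)$ is the number of words of length $n$ in $L$. For an infinite word $x$, $\mathrm{Fac}(x)$ is the set of all finite blocks of consecutive letters of $x$, including the empty word, and $p_x(n)=p_{\mathrm{Fac}(x)}(n)$. $S^k$ denotes the set of all concatenations of $k$ elements of $S$. For real $\alpha\ge 0$, $\mathcal{L}(\alpha)$ is the collection of languages $S$ over some finite nonempty alphabet with $p_S(n)=O(n^\alpha)$. The $\alpha$-dimension of $x$ is $d_\alpha(x)=\inf\{k\ge 1 : \mathrm{Fac}(x)\subseteq S^k \text{ for some } S\in\mathcal{L}(\alpha)\}$, with $\inf\emptyset=+\infty$; so $d_0$ uses languages $S$ with $p_S$ bounded. *)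

(* Defs.v *)
From mathcomp Require Import all_boot all_order all_algebra.
From mathcomp Require Import finmap.
From mathcomp Require Import all_classical all_reals all_analysis.

Set Implicit Arguments.
Unset Strict Implicit.
Unset Printing Implicit Defensive.

Import Order.TTheory GRing.Theory Num.Theory.
Import numFieldNormedType.Exports.

Local Open Scope classical_set_scope.
Local Open Scope ring_scope.

(* A language is a set of words [seq T] over an ambient type of letters [T];
   its alphabet is a finite set of letters of [T]. *)
Definition over_alphabet (T : choiceType) (A : set T) (S : set (seq T)) : Prop :=
  forall w, S w -> forall c, c \in w -> A c.

(* [fset_set] of an infinite set is empty; the set counted here is finite
   whenever [S] is a language over a finite alphabet. *)
Definition complexity (T : choiceType) (S : set (seq T)) (n : nat) : nat :=
  #|` fset_set [set w | S w /\ size w = n]|.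

Definition Fac (T : choiceType) (x : nat -> T) : set (seq T) :=
  [set w | exists i n, w = mkseq (fun j => x (i + j)%N) n].

Definition lang_pow (T : choiceType) (S : set (seq T)) (k : nat) :
    set (seq T) :=
  [set w | exists ws : k.-tuple (seq T),
     (forall i, S (tnth ws i)) /\ w = flatten ws].

Definition lang_class (R : realType) (T : choiceType) (alpha : R) :
    set (set (seq T)) :=
  [set S | (exists A : set T, [/\ finite_set A, A !=set0 & over_alphabet A S])
     /\ (fun n => (complexity S n)%:R : R^o) =O_\oo
        (fun n => n%:R `^ alpha : R^o)].

Definition alpha_dim (R : realType) (T : choiceType) (alpha : R)
    (x : nat -> T) : \bar R :=
  ereal_inf [set k%:R%:E | k in [set k : nat | (1 <= k)%N /\
     exists2 S, lang_class alpha S & Fac x `<=` lang_pow S k]].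

(* The infinite product [w 0 ++ w 1 ++ ...] of nonempty words: its prefix
   [w 0 ++ ... ++ w n] has more than [n] letters, so [x0] is never used. *)
Definition inf_prod (T : choiceType) (x0 : T) (w : nat -> seq T) : nat -> T :=
  fun n => nth x0 (flatten (mkseq w n.+1)) n.

Definition word_u (T : choiceType) (a b : T) : nat -> T :=
  inf_prod a (fun i => a :: nseq i.+1 b).

(* Main.v *)
Require Import Defs.
From mathcomp Require Import all_boot all_order all_algebra.
From mathcomp Require Import finmap.
From mathcomp Require Import all_classical all_reals all_analysis.
From mathcomp Require Import zify.

(** Apart from the powers of b, the factors of u are the ladders
      b^i . a b^m . a b^(m+1) ... a b^(m+l-1) . a b^j,
    and for i < m and j <= m + l every such word with m > 1 is a factor.

    Complexity. A factor of length n is the prefix of length n of some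
    b^i a b^m a b^(m+1) ..., and i and m may be truncated at n: at most
    (n+1)^2 words. Conversely the ladders b^i a b^m a b^j with m roughly
    between n/2 and 3n/4 and i < n/4 are factors, one of length n for each
    pair (i, m).

    Lower bound. Suppose that all factors are products x y z with x, y, z in S,
    where S has at most C words of each length, and call a word long if it has
    two letters a: a long factor knows its place in u. A long x determines (i, m)
    and a long z determines (j, m + l), but there are only O(n) words of S of
    length at most n, so for most (m, l) some (i, j) admits neither. Then y is
    long and determines (m, l) up to four possibilities. The number of pairs
    (m, l) whose ladder is shorter than n grows like n log n (sum n / l over
    l), which exceeds O(n). In [triple_cover_card] the logarithm appears as J
    dyadic scales l ~ 2^s, each contributing the same number H 2^J of pairs, and
    the three cases are counted together in one cardinality estimate;
    [no_triple_cover] chooses J, then H, so that the estimate fails.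

    Upper bound. Write M = m + l - 1 for the last full run. Cutting next to an
    index P with m <= P <= M splits the ladder into
      (b^i a) (b^d) (X) (Y) (b^d') (a b^j),
    where X is b^m a b^(m+1) ... a b^P without d of its leading letters b, and
    Y is a b^(P+1) ... a b^M without d' of its trailing ones. The words b^n,
    b^n a and a b^n are one per length, so X and Y are what matters. By
    [midpoint], P can be taken divisible by a power of 2 exceeding both P - m
    and M - P; this makes the pairs (P, k), where k is the number of letters a
    in X or Y, so sparse that only O(n) of them give words of length at most n.
    The freedom in d and d' then spreads the lengths evenly: d is chosen such
    that the residue of the length modulo a suitable power of 2 encodes part of
    (P, k), and [stamp_inj] recovers (P, k) from the length and two more bits.
    Hence the words X and Y fall into four languages each, having at most one
    word of each length ([thin_left], [thin_right]), apart from trivial words of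
    the forms above and from one exceptional family ([thin_base]), which is also
    one word per length. *)

Set Implicit Arguments.
Unset Strict Implicit.
Unset Printing Implicit Defensive.

Import Order.TTheory GRing.Theory Num.Theory.
Import numFieldNormedType.Exports.

Local Open Scope classical_set_scope.
Local Open Scope nat_scope.

(** * Runs, climbs and ladders *)

Section Words.
Variables (T : eqType) (a b : T).

(** The block starting at the run b^m; the word u is the limit of the prefixes
    [climb 1 N]. *)
Definition climb m l : seq T := flatten [seq a :: nseq q b | q <- iota m l].
Definition ladder i m l j : seq T := nseq i b ++ climb m l ++ a :: nseq j b.

Lemma climbS m l : climb m l.+1 = a :: nseq m b ++ climb m.+1 l.
Proof. by []. Qed.

Lemma climbD m l l' : climb m (l + l') = climb m l ++ climb (m + l) l'.
Proof. by rewrite /climb iotaD map_cat flatten_cat. Qed.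

Lemma climbSr m l : climb m l.+1 = climb m l ++ a :: nseq (m + l) b.
Proof. by rewrite -addn1 climbD climbS cats0. Qed.

Lemma size_climb m l : size (climb m l) = l * m.+1 + 'C(l, 2).
Proof.
elim: l => [|l IH]; first by rewrite mul0n bin0n.
by rewrite climbSr size_cat IH /= size_nseq binS bin1; lia.
Qed.

Lemma take_climb n m l :
  take n (climb m l) = [::] \/
  exists l' j, take n (climb m l) = climb m l' ++ a :: nseq j b.
Proof.
elim: l n m => [|l IH] [|n] m; try by left.
right; rewrite climbS [take _ _]/= take_cat size_nseq; case: ltnP => nm.
  by exists 0, n; rewrite take_nseq // ltnW.
case: (IH (n - m) m.+1) => [->|[l' [j ->]]]; first by exists 0, m; rewrite cats0.
by exists l'.+1, j; rewrite climbS /= catA.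
Qed.

Lemma drop_climb s m l : exists i m' l', m <= m' /\
  drop s (climb m l) = nseq i b ++ climb m' l'.
Proof.
elim: l s m => [|l IH] [|s] m; try by exists 0, m, 0.
  by exists 0, m, l.+1; rewrite drop0.
rewrite climbS [drop _ _]/= drop_cat size_nseq; case: ltnP => sm.
  by exists (m - s), m.+1, l; rewrite drop_nseq.
have [i [m' [l' [lt ->]]]] := IH (s - m) m.+1.
by exists i, m', l'; split; first exact: ltnW.
Qed.

Lemma take_climb_len n m l : n <= size (climb m l) -> take n (climb m l) = take n (climb m n).
Proof.
have pre k k' : k <= k' -> n <= size (climb m k) ->
    take n (climb m k') = take n (climb m k).
  by move=> /subnKC <- nk; rewrite climbD takel_cat.
move=> nl; case: (leqP n l) => [nl'|/ltnW ln].
  by apply: pre => //; rewrite size_climb; lia.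
by rewrite (pre _ _ ln).
Qed.

Lemma size_ladder i m l j : size (ladder i m l j) = i + (l * m.+1 + 'C(l, 2)) + j.+1.
Proof. by rewrite !size_cat size_climb /= !size_nseq addnA. Qed.

Lemma size_climb_ge m l : l <= size (climb m l).
Proof. by rewrite size_climb; nia. Qed.

Lemma nth_climb x0 m l l' n : n < size (climb m l) -> n < size (climb m l') ->
  nth x0 (climb m l) n = nth x0 (climb m l') n.
Proof.
move=> nl nl'; case: (leqP l l') => [/subnKC <-|/ltnW/subnKC <-].
  by rewrite (climbD _ l) [RHS]nth_cat nl.
by rewrite (climbD _ l') [LHS]nth_cat nl'.
Qed.

Lemma ladder_infix i m l j : 1 < m -> i < m -> j <= m + l ->
  exists N p s, climb 1 N = p ++ ladder i m l j ++ s.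
Proof.
case: m => [|[|m]] // _ im jm.
exists (m + (1 + (l + 1))), (climb 1 m ++ a :: nseq (m.+1 - i) b), (nseq (m.+2 + l - j) b).
have e1 : nseq m.+1 b = nseq (m.+1 - i) b ++ nseq i b by rewrite -nseqD subnK.
have e2 : nseq (m.+2 + l) b = nseq j b ++ nseq (m.+2 + l - j) b.
  by rewrite -nseqD subnKC.
have c1 k : climb k 1 = a :: nseq k b by rewrite climbS cats0.
rewrite (climbD _ m) (climbD _ 1) (climbD _ l) !c1.
by rewrite add1n addn1 e2 e1 /ladder -!catA /= -!catA.
Qed.

Lemma take_drop_climb s n : exists i m, 0 < m /\
  take n (drop s (climb 1 (s + n))) = take n (nseq i b ++ climb m n).
Proof.
have sz := size_climb_ge 1 (s + n).
have [i [m [l [m0 dE]]]] := drop_climb s 1 (s + n).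
have szd : n <= i + size (climb m l).
  by move: (congr1 size dE); rewrite size_drop size_cat size_nseq; lia.
exists i, m; split=> //; rewrite dE !take_cat size_nseq; case: ltnP => // ni.
rewrite take_climb_len ?leq_subLR // [in RHS]take_climb_len //.
by apply: leq_trans (size_climb_ge m n); apply: leq_subr.
Qed.

Lemma take_shape n i m l : let w := take n (nseq i b ++ climb m l) in
  (exists k, w = nseq k b) \/ exists k j, w = ladder i m k j.
Proof.
rewrite /= take_cat size_nseq; case: ltnP => [ni|_].
  by left; exists n; rewrite take_nseq // ltnW.
case: (take_climb (n - i) m l) => [->|[k [j ->]]].
  by left; exists i; rewrite cats0.
by right; exists k, j.
Qed.

(** A prefix of length at most n cannot tell a first run of length n from a
    longer one, so that finitely many m suffice for each length. *)
Lemma take_climb_min n k m : k <= n ->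
  take k (climb m n) = take k (climb (minn m n) n).
Proof.
have cE q l r : r <= q -> take r.+1 (climb q l.+1) = a :: nseq r b.
  by move=> rq; rewrite climbS /= takel_cat ?size_nseq ?take_nseq.
case: n k => [|n] [|k] kn; rewrite ?take0 ?ltn0 //.
by case: (leqP m n.+1) => // nm; rewrite !cE //; lia.
Qed.

(** Only (n+1)^2 pairs (i, m) matter for words of length n. *)
Lemma take_slope_min n i m : take n (nseq i b ++ climb m n) =
  take n (nseq (minn i n) b ++ climb (minn m n) n).
Proof.
rewrite !take_cat !size_nseq; case: (ltnP i n) => ni.
  by rewrite ltnNge ltnW //= take_climb_min // leq_subr.
move: ni; rewrite ltnn subnn take0 cats0 leq_eqVlt => /predU1P[->|ni].
  by rewrite ltnn subnn take0 cats0.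
by rewrite ni take_nseq // ltnW.
Qed.

(** The length of the p-th run between letters a, the runs before the first a
    and after the last a included. Its additivity [gap_cat] lets a run of a
    ladder be read off inside any factor that contains both of its delimiters.
    *)
Fixpoint gap (w : seq T) p : nat :=
  if w is c :: w' then
    if c == a then (if p is p'.+1 then gap w' p' else 0) else (p == 0) + gap w' p
  else 0.

Lemma gap_cat x y p :
  gap (x ++ y) p =
  gap x p + (if count_mem a x <= p then gap y (p - count_mem a x) else 0).
Proof.
elim: x p => [|c x IH] p /=; first by rewrite subn0.
case: eqP => /= _; last by rewrite add0n IH addnA.
by case: p => [|p] //; rewrite IH add1n ltnS subSS.
Qed.

Lemma gap_high x p : count_mem a x < p -> gap x p = 0.
Proof.
elim: x p => [//|c x IH] p /=; case: eqP => /= _; last by case: p => // p /IH.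
by case: p => // p; rewrite add1n ltnS => /IH.
Qed.

Lemma gap_catl x y p : p < count_mem a x -> gap (x ++ y) p = gap x p.
Proof. by move=> px; rewrite gap_cat leqNgt px addn0. Qed.

Lemma gap_catr x y p : 0 < p -> gap (x ++ y) (count_mem a x + p) = gap y p.
Proof.
by move=> p0; rewrite gap_cat gap_high ?leq_addr ?addKn // -addn1 leq_add2l.
Qed.

Hypothesis hab : a != b.

Lemma count_climb m l : count_mem a (climb m l) = l.
Proof.
elim: l m => [//|l IH] m.
by rewrite climbS /= eqxx count_cat IH count_nseq /= eq_sym (negbTE hab).
Qed.

Lemma gap_nseq i p : gap (nseq i b) p = if p == 0 then i else 0.
Proof.
elim: i => [|i IH] /=; first by case: eqP.
by rewrite eq_sym (negbTE hab) IH; case: eqP.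
Qed.

Lemma gap_climb m l j p : gap (climb m l ++ a :: nseq j b) p.+1 =
  if p < l then m + p else if p == l then j else 0.
Proof.
elim: l m p => [|l IH] m p; first by rewrite /= eqxx gap_nseq.
rewrite climbS /= eqxx -catA gap_cat gap_nseq count_nseq /= [b == a]eq_sym (negbTE hab) subn0.
case: p => [|p] /=; last by rewrite IH addSnnS.
case: l {IH} => [|l]; rewrite /= eqxx; lia.
Qed.

Lemma count_ladder i m l j : count_mem a (ladder i m l j) = l.+1.
Proof.
by rewrite !count_cat count_climb /= !count_nseq /= eqxx eq_sym (negbTE hab); lia.
Qed.

Lemma gap_ladder_first i m l j : gap (ladder i m l j) 0 = i.
Proof.
rewrite /ladder gap_cat gap_nseq /= count_nseq /= eq_sym (negbTE hab) mul0n /=.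
by case: l => [|l]; rewrite ?climbS /= eqxx addn0.
Qed.

Lemma gap_ladderS i m l j p : gap (ladder i m l j) p.+1 =
  if p < l then m + p else if p == l then j else 0.
Proof.
by rewrite /ladder gap_cat gap_nseq count_nseq /= [b == a]eq_sym (negbTE hab) subn0 gap_climb.
Qed.

(** The second run of x is closed by the second letter a of x, so it is a full
    run of the ladder. *)
Lemma ladder_left i m l j x y : 0 < l -> ladder i m l j = x ++ y ->
  1 < count_mem a x -> (gap x 0 = i) * (gap x 1 = m).
Proof.
move=> l0 e cx; rewrite -(gap_catl y (ltnW cx)) -(gap_catl y cx) -e.
by rewrite gap_ladder_first gap_ladderS l0 addn0.
Qed.

(** Mirror image of [ladder_left]: the run before the last letter a of y is a
    full run of the ladder, and the one after it is the final run. *)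
Lemma ladder_right i m l j x y : 0 < l -> ladder i m l j = x ++ y ->
  1 < count_mem a y ->
  (gap y (count_mem a y) = j) * (gap y (count_mem a y).-1 = m + l.-1).
Proof.
move=> l0 e cy.
have cE : count_mem a x + count_mem a y = l.+1.
  by rewrite -count_cat -e count_ladder.
have gE p : 0 < p -> gap y p = gap (ladder i m l j) (count_mem a x + p).-1.+1.
  by move=> p0; rewrite prednK ?addn_gt0 ?p0 ?orbT // e gap_catr.
have [p0 p1] : 0 < count_mem a y /\ 0 < (count_mem a y).-1 by lia.
rewrite !gE // cE !gap_ladderS ltnn eqxx.
have -> : (count_mem a x + (count_mem a y).-1).-1 = l.-1 by lia.
by rewrite prednK ?leqnn.
Qed.

(** The outer factors swallow at most one letter a each, which shifts the
    first and the last full run visible in y by at most one. With l > 2 there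
    remain two letters a in y, so both runs exist. *)
Lemma ladder_middle i m l j x y z : 2 < l -> ladder i m l j = x ++ y ++ z ->
  count_mem a x <= 1 -> count_mem a z <= 1 ->
  (gap y 1 = m + count_mem a x) *
  (gap y (count_mem a y).-1 + count_mem a z = m + l.-1).
Proof.
move=> l2 e cx cz.
have cE : count_mem a x + (count_mem a y + count_mem a z) = l.+1.
  by rewrite -!count_cat -e count_ladder.
have gE p : 0 < p < count_mem a y -> gap y p = m + (count_mem a x + p).-1.
  move=> /andP[p0 py]; rewrite -(gap_catl z py) -(gap_catr x _ p0) -e.
  have -> : count_mem a x + p = (count_mem a x + p).-1.+1 by lia.
  by rewrite gap_ladderS ifT //=; lia.
by split; rewrite gE; lia.
Qed.

End Words.

(** * Factors of u *)

Section Factors.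
Variables (T : choiceType) (a b : T).
Local Notation u := (word_u a b).
Local Notation climb := (climb a b).
Local Notation ladder := (ladder a b).

(** The letter u n is read in a prefix that depends on n; any longer prefix
    gives the same one. *)
Lemma word_u_climb N n : n < size (climb 1 N) -> u n = nth a (climb 1 N) n.
Proof.
move=> nN; rewrite -(nth_climb a (size_climb_ge a b 1 n.+1) nN).
rewrite /word_u /inf_prod /mkseq; congr (nth a (flatten _) n).
by rewrite (iotaDl 1 0) -map_comp.
Qed.

Lemma infix_fac N p w s : climb 1 N = p ++ w ++ s -> Fac u w.
Proof.
move=> e; exists (size p), (size w); apply: (@eq_from_nth _ a).
  by rewrite size_mkseq.
move=> j jw; rewrite nth_mkseq // (@word_u_climb N); last first.
  by rewrite e !size_cat ltn_add2l ltn_addr.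
by rewrite e nth_cat ltnNge leq_addr addKn nth_cat jw.
Qed.

Lemma ladder_fac i m l j : 1 < m -> i < m -> j <= m + l -> Fac u (ladder i m l j).
Proof.
by move=> m1 im jm; have [N [p [s /infix_fac]]] := ladder_infix a b m1 im jm.
Qed.

Lemma fac_take w : Fac u w -> exists i m, 0 < m /\
  w = take (size w) (nseq i b ++ climb m (size w)).
Proof.
move=> [s [n ->]]; rewrite size_mkseq.
have [i [m [m0 e]]] := take_drop_climb a b s n; exists i, m; split=> //; rewrite -{}e.
have sz : n <= size (drop s (climb 1 (s + n))).
  by rewrite size_drop leq_subRL (leq_trans _ (size_climb_ge _ _ _ _)) ?leq_addr.
apply: (@eq_from_nth _ a) => [|j]; first by rewrite size_mkseq size_takel.
rewrite size_mkseq => jn; rewrite nth_mkseq // nth_take // nth_drop.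
apply: word_u_climb; apply: leq_trans (size_climb_ge _ _ _ _).
by rewrite ltn_add2l.
Qed.

Lemma fac_shape w : Fac u w -> (exists i, w = nseq i b) \/
  exists i m l j, 0 < m /\ w = ladder i m l j.
Proof.
move=> /fac_take [i [m [m0 ->]]].
have [[k ->]|[k [j ->]]] := take_shape a b (size w) i m (size w); first by left; exists k.
by right; exists i, m, k, j.
Qed.

(** Contains all factors of length n, though not only factors. *)
Definition fac_list n : seq (seq T) :=
  [seq take n (nseq i b ++ climb m n) | i <- iota 0 n.+1, m <- iota 0 n.+1].

Lemma fac_in_list w : Fac u w -> w \in fac_list (size w).
Proof.
move=> /fac_take [i [m [_ e]]]; apply/allpairsP.
exists (minn i (size w), minn m (size w)); rewrite !mem_iota /= !ltnS !geq_minr.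
by split=> //; rewrite -take_slope_min.
Qed.

End Factors.

(** * Counting words of a language *)

(** For a thin language a word is known from its length; a union of K thin
    languages has complexity at most K. *)
Definition thin (T : Type) (S : seq T -> Prop) :=
  forall w w', S w -> S w' -> size w = size w' -> w = w'.

Section Complexity.
Variables (T : choiceType).
Implicit Type S : set (seq T).

Lemma complexity_le S n (s : seq (seq T)) :
  (forall w, S w -> size w = n -> w \in s) -> complexity S n <= size s.
Proof.
move=> sub; have fin : finite_set [set w | S w /\ size w = n].
  by apply: (sub_finite_set _ (finite_seq s)) => w /= [Sw wn]; apply: sub.
rewrite /complexity; apply: uniq_leq_size (fset_uniq _) _ => w.
by rewrite in_fset_set // inE => -[Sw wn]; apply: sub.
Qed.

Lemma complexity_ge S n (s : seq (seq T)) :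
  finite_set [set w | S w /\ size w = n] -> uniq s ->
  (forall w, w \in s -> S w /\ size w = n) -> size s <= complexity S n.
Proof.
move=> fin us sub; apply: uniq_leq_size us _ => w /sub [Sw wn].
by rewrite in_fset_set // inE.
Qed.

Lemma finite_words (A : set T) S n : finite_set A -> over_alphabet A S ->
  finite_set [set w | S w /\ size w = n].
Proof.
move=> fA SA; suff fin : finite_set [set w : seq T | (forall c, c \in w -> A c) /\ size w = n].
  by apply: sub_finite_set fin => w /= [Sw wn]; split=> // c; apply: SA.
elim: n {S SA} => [|n IH].
  apply: sub_finite_set (finite_set1 [::]) => w /= [_ /size0nil]; exact.
apply: sub_finite_set (finite_image2 cons fA IH) => w /= [].
case: w => // c w wA [wn].
exists c; first by apply: wA; rewrite mem_head.
by exists w => //; split=> // d dw; apply: wA; rewrite inE dw orbT.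
Qed.

Lemma complexity_thin_cover (P : nat -> seq T -> Prop) K n :
  (forall c, thin (P c)) -> complexity [set w | exists2 c, c < K & P c w] n <= K.
Proof.
move=> thinP; rewrite -[leqRHS](size_iota 0) -(size_map
  (fun c => xget [::] [set w | P c w /\ size w = n])).
apply: complexity_le => w [c cK Pw] wn; apply/mapP; exists c; first by rewrite mem_iota.
have [Px xn] := @xgetPex _ [::] [set w | P c w /\ size w = n] (ex_intro _ w (conj Pw wn)).
by apply: thinP Pw Px _; rewrite xn.
Qed.

End Complexity.

(** * Quadratic complexity *)

Lemma complexity_u_le (T : choiceType) (a b : T) n :
  complexity (Fac (word_u a b)) n <= n.+1 * n.+1.
Proof.
have -> : n.+1 * n.+1 = size (fac_list a b n) by rewrite size_allpairs !size_iota.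
by apply: complexity_le => w Fw <-; apply: fac_in_list.
Qed.

(** With q = n / 4, the ladders b^i a b^m a b^j with i < q and 2q <= m < 3q
    fit into length n, and the constraint j <= m + 1 holds because less than
    2q + 2 letters remain. The pair (i, m) is read off by [gap]. *)
Lemma complexity_u_ge (T : choiceType) (a b : T) n : a != b -> 4 <= n ->
  n * n <= 49 * complexity (Fac (word_u a b)) n.
Proof.
move=> hab n4; pose q := n %/ 4.
pose f i m := ladder a b i (2 * q + m) 1 (n - (2 + i + (2 * q + m))).
have qn : 4 * q <= n < 4 * q + 4 by rewrite /q; lia.
pose s := [seq f i m | i <- iota 0 q, m <- iota 0 q].
have fin : finite_set [set w | Fac (word_u a b) w /\ size w = n].
  apply: sub_finite_set (finite_seq (fac_list a b n)) => w /= [Fw wn].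
  by have := fac_in_list Fw; rewrite wn.
have : size s <= complexity (Fac (word_u a b)) n.
  apply: complexity_ge fin _ _.
    apply: allpairs_uniq; rewrite ?iota_uniq // => -[i m] [i' m'] _ _ /= e.
    have := congr1 (gap a ^~ 0) e; have := congr1 (gap a ^~ 1) e.
    by rewrite /f !gap_ladderS // !gap_ladder_first //= => ? ?; congr (_, _); lia.
  move=> w /allpairsP[[i m] [/=]]; rewrite !mem_iota /= !add0n => iq mq ->.
  split; first by apply: ladder_fac; lia.
  by rewrite size_ladder mul1n (bin_small (isT : 1 < 2)); lia.
rewrite size_allpairs !size_iota => sq.
have : n * n <= (7 * q) * (7 * q) by apply: leq_mul; lia.
by lia.
Qed.

(** * Three factors are not enough *)

(** Ladders used for the lower bound: a scale s < J, an index t < H 2^J and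
    two outer exponents below H. At scale s the index t encodes 2^s values of
    l and H 2^(J-s) values of m, so that l m is at most of the order of H 2^J
    at every scale and all scales have equally many pairs. *)
Definition box J H : finType := ('I_J * 'I_(H * 2 ^ J) * ('I_H * 'I_H))%type.

Definition box_params J H (q : box J H) : (nat * nat) * (nat * nat) :=
  let: (s, t, (i, j)) := q in
  ((H.+1 + t %/ 2 ^ s, 2 ^ s + t %% 2 ^ s + 2), (i : nat, j : nat)).

(** The scale is the logarithm of l - 2; the summand 2 in l only serves to
    keep l > 2 for [ladder_middle]. *)
Lemma box_params_inj J H : injective (@box_params J H).
Proof.
move=> [[s t] [i j]] [[s' t'] [i' j']] [em el /ord_inj -> /ord_inj ->].
have lt r (u : nat) : u %% 2 ^ r < 2 ^ r by rewrite ltn_mod expn_gt0.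
have es : s = s' :> nat.
  have sE r (u : nat) : trunc_log 2 (2 ^ r + u %% 2 ^ r) = r.
    by apply: trunc_log_eq => //; rewrite leq_addr expnS mul2n -addnn ltn_add2l lt.
  by rewrite -(sE s t) -(sE s' t'); congr trunc_log; move: el; lia.
rewrite -(ord_inj es) in em el *; congr (_, _, _); apply: ord_inj.
by rewrite (divn_eq t (2 ^ s)) (divn_eq t' (2 ^ s)); congr (_ * _ + _); lia.
Qed.

Lemma card_box J H : #|box J H| = J * (H * 2 ^ J) * (H * H).
Proof. by rewrite !card_prod !card_ord. Qed.

Lemma box_params_bounds J H (q : box J H) :
  let: ((m, l), (i, j)) := box_params q in
  [/\ i < H, j < H, H < m & 2 < l <= 3 * 2 ^ J] /\
  (2 ^ J <= H -> i + (l * m.+1 + 'C(l, 2)) + j.+1 <= 21 * (H * 2 ^ J)).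
Proof.
case: q => [[s t] [i j]] /=.
have eJ : 2 ^ J = 2 ^ s * 2 ^ (J - s) by rewrite -expnD subnKC // ltnW.
have t1 : t %% 2 ^ s < 2 ^ s by rewrite ltn_mod expn_gt0.
have t2 : t %/ 2 ^ s < H * 2 ^ (J - s).
  by rewrite ltn_divLR ?expn_gt0 // -mulnA [2 ^ (J - s) * _]mulnC -eJ.
have s1 : 0 < 2 ^ s by rewrite expn_gt0.
have s2 : 2 <= 2 ^ (J - s).
  by rewrite -{1}(expn1 2) leq_exp2l // subn_gt0.
have := ltn_ord i; have := ltn_ord j.
set P := 2 ^ s in eJ t1 t2 s1 *; set Q := 2 ^ (J - s) in eJ t2 s2 *.
move: (t %% P) t1 (t %/ P) t2 => u t1 v t2; rewrite eJ => jH iH.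
have lP : 2 < P + u + 2 <= 3 * P by lia.
split; first by split=> //; [lia|nia].
move=> hH; set l := P + u + 2 in lP *.
have b2 : 'C(l, 2) * 2 <= l * l by rewrite bin2; nia.
have l1 : l * (H.+1 + v).+1 <= (3 * P) * (3 * (H * Q)).
  by apply: leq_mul; [lia|nia].
have l2 : l * l <= (3 * P) * (3 * P) by apply: leq_mul; lia.
have l3 : P * P <= H * (P * Q) by nia.
have l4 : H <= H * (P * Q) by nia.
have := mulnCA P H Q; nia.
Qed.

Section Count.
Variables (T : eqType) (a b : T).
Hypothesis hab : a != b.

(** Each ladder of the box is recovered from one word of W and some bounded
    data: if x is long, from x, l and j; if z is long, from z, l and i;
    otherwise from y, i, j and the numbers of letters a in x and z. The two
    terms on the right count these data, and the left side counts the box. *)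
Lemma triple_cover_card J H n (W : seq (seq T)) :
  2 ^ J <= H -> 21 * (H * 2 ^ J) <= n ->
  (forall i m l j, i < H -> j < H -> H < m -> size (ladder a b i m l j) <= n ->
    exists x y z, [/\ x \in W, y \in W, z \in W & ladder a b i m l j = x ++ y ++ z]) ->
  J * (H * 2 ^ J) * (H * H) <=
    size W * (6 * 2 ^ J).+1 * H * 2 + size W * 4 * (H * H).
Proof.
move=> JH nE cov.
pose L := (3 * 2 ^ J).+1.
pose DLj := [seq (l, j) | l <- iota 0 L, j <- iota 0 H].
pose Def := [seq (d, ij) | d <- [seq (e, f) | e <- iota 0 2, f <- iota 0 2],
                           ij <- [seq (i, j) | i <- iota 0 H, j <- iota 0 H]].
pose A1 := [seq ((gap a x 1, d.1), (gap a x 0, d.2)) | x <- W, d <- DLj].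
pose A2 := [seq ((gap a z (count_mem a z).-1 - d.1.-1, d.1),
                 (d.2, gap a z (count_mem a z))) | z <- W, d <- DLj].
pose A3 := [seq ((gap a y 1 - d.1.1,
                  gap a y (count_mem a y).-1 + d.1.2 + 1 - (gap a y 1 - d.1.1)),
                 d.2) | y <- W, d <- Def].
(* A1, A2 and A3 decode the cases x long, z long, and only y long. *)
have sub : {subset map (@box_params J H) (enum (box J H)) <= A1 ++ A2 ++ A3}.
  move=> _ /mapP[q _ ->]; have := box_params_bounds q.
  case: (box_params q) => [[m l] [i j]] [[iH jH mH /andP[l3 lL]] /(_ JH) sz].
  have l0 : 0 < l by lia.
  have [//|//|//||x [y [z [xW yW zW e]]]] := cov i m l j.
    by rewrite size_ladder; apply: leq_trans sz nE.
  rewrite !mem_cat; case: (ltnP 1 (count_mem a x)) => cx.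
    have [ei em] := ladder_left hab l0 e cx.
    apply/orP; left; apply/allpairsP; exists (x, (l, j)); rewrite /= ei em.
    by split=> //; apply: allpairs_f; rewrite mem_iota //= /L add0n; lia.
  case: (ltnP 1 (count_mem a z)) => cz.
    rewrite catA in e; have [ej em] := ladder_right hab l0 e cz.
    apply/orP; right; apply/orP; left; apply/allpairsP; exists (z, (l, i)).
    rewrite /= ej em addnK.
    by split=> //; apply: allpairs_f; rewrite mem_iota //= /L add0n; lia.
  have [e1 e2] := ladder_middle hab l3 e cx cz.
  apply/orP; right; apply/orP; right; apply/allpairsP.
  exists (y, ((count_mem a x, count_mem a z), (i, j))); rewrite /= e1 e2 addnK.
  split=> //; last by congr (_, _, _); lia.
  by do 2!apply: allpairs_f; rewrite ?mem_iota //=; apply: allpairs_f; rewrite mem_iota.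
have := uniq_leq_size _ sub; rewrite map_inj_uniq ?enum_uniq; last exact: box_params_inj.
move=> /(_ isT); rewrite size_map -cardE card_box !size_cat !size_allpairs !size_iota /L.
nia.
Qed.

(** J = 88 C + 1 makes the box exceed the data of the third kind by H^3 2^J.
    The data of the other two kinds number about C 4^J H^2, which is less once
    H is large compared with C 2^J. *)
Lemma no_triple_cover C :
  0 < C -> exists H n, forall W : seq (seq T), size W <= C * n.+1 ->
  ~ (forall i m l j, i < H -> j < H -> H < m -> size (ladder a b i m l j) <= n ->
    exists x y z, [/\ x \in W, y \in W, z \in W & ladder a b i m l j = x ++ y ++ z]).
Proof.
move=> C0; pose J := 88 * C + 1; pose H := 308 * C * 2 ^ J + 1.
(* 21 H 2^J bounds the length of the ladders of the box. *)
exists H, (21 * (H * 2 ^ J)) => W sW cov.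
have H0 : 0 < H by rewrite /H addn1.
have P0 : 0 < 2 ^ J by rewrite expn_gt0.
have JH : 2 ^ J <= H by rewrite /H; nia.
have := triple_cover_card JH (leqnn _) cov.
have {}sW : size W <= C * (22 * (H * 2 ^ J)).
  by apply: leq_trans sW _; rewrite leq_mul2l; apply/orP; right; nia.
have HE : 308 * C * 2 ^ J < H by rewrite /H addn1.
move: (size W) sW HE P0 H0 => w; rewrite {JH cov}; move: (2 ^ J) => P sw HE P0 H0.
have s1 : w * (6 * P).+1 * H * 2 <= C * (22 * (H * P)) * (7 * P) * H * 2.
  by do 2!(rewrite leq_mul2r; apply/orP; right); apply: leq_mul => //; lia.
have s2 : w * 4 * (H * H) <= C * (22 * (H * P)) * 4 * (H * H).
  by do 2!(rewrite leq_mul2r; apply/orP; right).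
move=> s; have {s s1 s2} : J * (H * P) * (H * H) <=
   (308 * C * P) * (H * P * H) + 88 * C * (H * P) * (H * H).
  by apply: leq_trans s _; apply: leq_trans (leq_add s1 s2) _; nia.
rewrite /J 2!mulnDl mul1n [X in X <= _]addnC leq_add2r leqNgt => /negP; apply.
have -> : H * P * (H * H) = H * (H * P * H) by lia.
by rewrite ltn_mul2r HE !muln_gt0 H0 P0.
Qed.

End Count.

Lemma lang_class0_bounded (R : realType) (T : choiceType) (S : set (seq T)) :
  lang_class (0 : R)%R S -> exists C, forall n, complexity S n <= C.
Proof.
move=> [_ /eqO_exP[k k0 [N _ h]]].
exists (Num.bound k + \max_(i < N) complexity S i) => n; case: (ltnP n N) => nN.
  by apply: leq_trans (leq_addl _ _); apply: (leq_bigmax (Ordinal nN)).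
apply: leq_trans (leq_addr _ _); have := h n nN.
rewrite /= powRr0 normr1 mulr1 ger0_norm ?ler0n // => /le_lt_trans.
by move=> /(_ _ (archi_boundP (ltW k0))); rewrite ltr_nat => /ltnW.
Qed.

Lemma complexity_words (R : realType) (T : choiceType) (S : set (seq T)) n :
  lang_class (0 : R)%R S -> exists2 s : seq (seq T), size s = complexity S n &
  forall w, S w -> size w = n -> w \in s.
Proof.
move=> [[A [fA _ SA]] _].
exists (enum_fset (fset_set [set w | S w /\ size w = n])) => // w Sw wn.
by rewrite in_fset_set ?inE //; apply: finite_words SA.
Qed.

(** The empty word is included because shorter products are padded with it. *)
Lemma short_words (R : realType) (T : choiceType) (S : set (seq T)) :
  lang_class (0 : R)%R S -> exists2 C, 0 < C & forall n,
  exists2 W : seq (seq T), size W <= C * n.+1 &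
  forall w, S w \/ w = [::] -> size w <= n -> w \in W.
Proof.
move=> Scl; have [C bC] := lang_class0_bounded Scl.
exists C.+1 => //; elim=> [|n [W sW mW]].
  have [s ss ms] := complexity_words 0 Scl.
  exists ([::] :: s); first by rewrite /= ss muln1 ltnS.
  by move=> w [Sw|-> _]; rewrite inE ?eqxx // leqn0 => /eqP /(ms _ Sw) ->; rewrite orbT.
have [s ss ms] := complexity_words n.+1 Scl.
exists (s ++ W); first by rewrite size_cat ss mulnS leq_add // leqW.
move=> w Sw; rewrite mem_cat leq_eqVlt => /orP[/eqP wn|wn]; last by rewrite (mW w) ?orbT.
by case: Sw wn => [Sw /(ms _ Sw) ->//|->].
Qed.

Lemma lang_pow_triple (T : choiceType) (S : set (seq T)) k w : k <= 3 -> lang_pow S k w ->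
  exists x y z, [/\ S x \/ x = [::], S y \/ y = [::], S z \/ z = [::] & w = x ++ y ++ z].
Proof.
move=> k3 [ws [mem ->]].
have {}mem : forall x, x \in tval ws -> S x by move=> x /tnthP[i ->].
case: ws mem => s /= /eqP sk mem; subst k.
have nS i : S (nth [::] s i) \/ nth [::] s i = [::].
  by case: (ltnP i (size s)) => [/(mem_nth [::])/mem|/(nth_default [::])]; [left|right].
exists (nth [::] s 0), (nth [::] s 1), (nth [::] s 2); split=> //.
by case: s k3 {mem nS} => [|x [|y [|z [|t s]]]] //=; rewrite ?cats0.
Qed.

Lemma no_cube_cover (R : realType) (T : choiceType) (a b : T) (S : set (seq T)) k :
  a != b -> lang_class (0 : R)%R S -> k <= 3 ->
  ~ Fac (word_u a b) `<=` lang_pow S k.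
Proof.
move=> hab Scl k3 sub; have [C C0 hC] := short_words Scl.
have [H [n no]] := no_triple_cover hab C0; have [W sW mW] := hC n.
apply: (no W sW) => i m l j iH jH Hm sz.
have Fw : Fac (word_u a b) (ladder a b i m l j) by apply: ladder_fac; lia.
have [x [y [z [Sx Sy Sz e]]]] := lang_pow_triple k3 (sub _ Fw).
have le3 p q r : p + (q + r) <= n -> [/\ p <= n, q <= n & r <= n].
  by move=> ?; split; lia.
have [lx ly lz] : [/\ size x <= n, size y <= n & size z <= n].
  by apply: le3; move: sz; rewrite e !size_cat.
by exists x, y, z; split=> //; apply: mW.
Qed.

(** * Arithmetic of stamped lengths *)

(** The scale h of a stamp 2^h (2 p + 1) is its 2-adic valuation. *)
Lemma odd_partE h t : logn 2 (2 ^ h * t.*2.+1) = h.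
Proof.
rewrite lognM ?expn_gt0 // pfactorK // lognE.
by rewrite /= dvdn2 /= odd_double /= addn0.
Qed.

Lemma logn2_stamp h p f N :
  N = 2 ^ h * p.*2.+1 %[mod 2 ^ (h.+1 + f)] -> logn 2 N = h.
Proof.
move=> eN.
have [t ->] : exists t, N = 2 ^ h * t.*2.+1; last exact: odd_partE.
move: eN; rewrite expnD expnS => eN.
have d : 2 ^ h %| N.
  have: 2 * 2 ^ h * 2 ^ f = 2 ^ h * (2 * 2 ^ f) by lia.
  move: eN => /[swap] -> eN.
  rewrite (divn_eq N (2 ^ h * (2 * 2 ^ f))) eN dvdn_add //.
    by rewrite mulnCA dvdn_mulr.
  by rewrite -muln_modr dvdn_mulr.
move/dvdnP: d => [q eq]; exists q./2; rewrite {}eq in eN *.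
have: q * 2 ^ h = 2 ^ h * p.*2.+1 %[mod 2 ^ h * 2].
  by move: eN => /(congr1 (modn^~ (2 ^ h * 2))); rewrite !modn_dvdm // mulnC dvdn_mulr // mulnC.
rewrite mulnC -!muln_modr => /eqP; rewrite eqn_pmul2l ?expn_gt0 // => /eqP.
rewrite !modn2 /= odd_double /= => oq.
by rewrite -{1}(odd_double_half q); case: (odd q) oq => //; rewrite add1n.
Qed.

(** A ratio below 10 between two powers of 2 keeps the exponents within 3 of
    each other. *)
Lemma exp2_mod4_window a f f' : a > 0 -> f = f' %[mod 4] ->
  a * 2 ^ f < 10 * (a * 2 ^ f') -> a * 2 ^ f' < 10 * (a * 2 ^ f) -> f = f'.
Proof.
wlog ff' : f f' / f <= f' => [hw a0 e l1 l2|].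
  by case: (leqP f f') => [/hw|/ltnW/hw]; [apply|move=> h; symmetry; apply: h].
move=> a0 /esym/eqP; rewrite eqn_mod_dvd // => /dvdnP[q e] _.
have -> : f' = f + q * 4 by lia.
case: q e => [|q] _; first by rewrite mul0n addn0.
by rewrite expnD mulSn expnD; have := expn_gt0 2 (q * 4); have := expn_gt0 2 f; nia.
Qed.

Lemma mod_eq_window F p p' :
  F <= p < 2 * F -> F <= p' < 2 * F -> p = p' %[mod F] -> p = p'.
Proof.
move=> b b' e; have modE q : F <= q < 2 * F -> q %% F = q - F.
  by move=> bq; rewrite -{1}(subnK (n := q) (m := F)) ?modnDr ?modn_small; lia.
by move: e; rewrite !modE //; lia.
Qed.

(** N is a length obtained from the triple (h, p, k) by shortening [ell h p k]
    by less than the modulus 2^(h+1) 2^f, f being the logarithm of p, so that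
    it becomes congruent to the stamp 2^h (2 p + 1). The stamp encodes h and
    the residue of p modulo 2^f. The number k is not encoded: consecutive
    values of [ell h p] differ by more than the shortening. *)
Definition stamped (ell : nat -> nat -> nat -> nat) N h p k :=
  [/\ 0 < p, 2 ^ h <= k < 2 ^ h.+1,
    N <= ell h p k < N + 2 ^ (h.+1 + trunc_log 2 p),
    N = 2 ^ h * p.*2.+1 %[mod 2 ^ (h.+1 + trunc_log 2 p)] &
    4 ^ h * 2 ^ trunc_log 2 p < N <= 10 * (4 ^ h * 2 ^ trunc_log 2 p)].

(** The valuation of N is h. Its order of magnitude 4^h 2^f then leaves
    boundedly many f, among which f modulo 4 decides. Next p is known modulo
    2^f and lies between 2^f and 2^(f+1). Finally the windows of lengths
    belonging to different k are disjoint since the values of [ell] are spaced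
    by 2^(h+1) p, at least the modulus. *)
Lemma stamp_inj (ell : nat -> nat -> nat -> nat) N h p k h' p' k' :
  (forall h p k k', 0 < k < k' -> k' < 2 ^ h.+1 ->
     ell h p k + 2 ^ h.+1 * p <= ell h p k') ->
  stamped ell N h p k -> stamped ell N h' p' k' ->
  trunc_log 2 p = trunc_log 2 p' %[mod 4] ->
  [/\ h = h', p = p' & k = k'].
Proof.
move=> ellD [p0 /andP[hk kh] wN cN /andP[lN uN]].
move=> [p'0 /andP[hk' kh'] wN' cN' /andP[lN' uN']] e4.
have eh : h = h' by rewrite -(logn2_stamp cN) (logn2_stamp cN').
subst h'; have ef : trunc_log 2 p = trunc_log 2 p'.
  by apply: (@exp2_mod4_window (4 ^ h)); rewrite ?expn_gt0 //; lia.
have ep : p = p'.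
  have := trunc_log_bounds (isT : 1 < 2) p0.
  have := trunc_log_bounds (isT : 1 < 2) p'0.
  move: cN'; rewrite -ef cN; set f := trunc_log 2 p.
  rewrite expnD expnS [2 * 2 ^ h]mulnC -mulnA -!muln_modr => /eqP.
  rewrite eqn_pmul2l ?expn_gt0 // => /eqP e1.
  have : p = p' %[mod 2 ^ f].
    have e2 : p.*2 = p'.*2 %[mod 2 * 2 ^ f].
      by apply/eqP; rewrite -(eqn_modDr 1) !addn1; apply/eqP.
    by move: e2; rewrite -!mul2n -!muln_modr => /eqP; rewrite eqn_pmul2l // => /eqP.
  by rewrite /= expnS => e b' b; apply: mod_eq_window e.
subst p'; split=> //.
have M : 2 ^ (h.+1 + trunc_log 2 p) <= 2 ^ h.+1 * p.
  by rewrite expnD leq_mul2l trunc_logP // orbT.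
have k0 : 0 < k by apply: leq_trans hk; rewrite expn_gt0.
have k'0 : 0 < k' by apply: leq_trans hk'; rewrite expn_gt0.
case: (ltngtP k k') => // kk.
  by have := @ellD _ p k k' _ kh'; rewrite k0 kk => /(_ isT); lia.
by have := @ellD _ p k' k _ kh; rewrite k'0 kk => /(_ isT); lia.
Qed.

(** An index of maximal 2-adic valuation between m and M. The induction halves
    both ends; an odd end costs one unit, which the strict bounds absorb. *)
Lemma midpoint m M : 0 < m <= M ->
  exists e P, [/\ 2 ^ e %| P, m <= P <= M, P < m + 2 ^ e & M < P + 2 ^ e].
Proof.
elim/ltn_ind: M m => M IH m /andP[m0 mM].
case: (eqVneq m M) => [->|nmM].
  by exists 0, M; rewrite dvd1n leqnn; split=> //; lia.
have [||e [P [dP mPM h1 h2]]] := IH M./2 _ (uphalf m); try lia.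
by exists e.+1, P.*2; rewrite expnS -mul2n dvdn_pmul2l //; split=> //; lia.
Qed.

(** Shortening a word by less than M letters reaches any prescribed residue
    modulo M. *)
Lemma shift_residue l r M : 0 < M ->
  exists2 d, d < M & (d <= l -> l - d = r %[mod M]).
Proof.
move=> M0; exists ((l + (M - r %% M)) %% M); first by rewrite ltn_mod.
set d := (_ %% _) => dl; have rM := ltn_pmod r M0.
have := divn_eq (l + (M - r %% M)) M; rewrite -/d; set q := (_ %/ _) => e.
have {}e : l - d + M = q * M + r %% M by lia.
by rewrite -modnDr e modnMDl modn_mod.
Qed.

(** * Sizes of the two middle pieces *)

(** The size of b^(P-k) a b^(P-k+1) ... a b^P. *)
Definition left_size P k := (P - k) + (k * (P - k).+2 + 'C(k, 2)).

(** The size of a b^(P+1) ... a b^(P+k) for k > 0. *)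
Definition right_size P k := k.-1 * P.+2 + 'C(k.-1, 2) + (P + k).+1.

Lemma left_sizeS P k : k < P -> left_size P k.+1 = left_size P k + (P - k).
Proof. by move=> kP; rewrite /left_size binS bin1; nia. Qed.

Lemma right_sizeS P k : 0 < k -> right_size P k.+1 = right_size P k + (P + k.+2).
Proof. by case: k => // k _; rewrite /right_size /= binS bin1; lia. Qed.

Lemma step_gap (f : nat -> nat) D n :
  (forall k, 0 < k < n -> f k + D <= f k.+1) ->
  forall k k', 0 < k < k' -> k' <= n -> f k + D <= f k'.
Proof.
move=> st k k' /andP[k0]; elim: k' => // k' IH; rewrite ltnS leq_eqVlt.
case/orP=> [/eqP <- kn|kk kn]; first by apply: st; rewrite k0.
by have := IH kk (ltnW kn); have := st k'; rewrite kn (ltn_trans k0 kk) => /(_ isT); lia.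
Qed.

(** Raising k by one prepends the run b^(P-k-1) and a letter a, hence P - k
    letters, and k < 2^(h+1) leaves P - k > 2^(h+1) p. *)
Lemma left_size_gap h p k k' : 0 < k < k' -> k' < 2 ^ h.+1 ->
  left_size (2 ^ h.+1 * p.+1) k + 2 ^ h.+1 * p <= left_size (2 ^ h.+1 * p.+1) k'.
Proof.
move=> kk /ltnW; apply: step_gap kk => i /andP[_ ih].
by rewrite left_sizeS mulnS; lia.
Qed.

Lemma right_size_gap h p k k' : 0 < k < k' -> k' < 2 ^ h.+1 ->
  right_size (2 ^ h.+1 * p) k + 2 ^ h.+1 * p <= right_size (2 ^ h.+1 * p) k'.
Proof.
move=> kk /ltnW; apply: step_gap kk => i /andP[i0 ih].
by rewrite right_sizeS //; lia.
Qed.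

(** Here H = 2^h and F = 2^f: a left piece has about k ~ H runs, each of
    length about P ~ H F, whence the order of magnitude H^2 F. The inequality
    on d says that there are enough letters b to remove. *)
Lemma left_size_range H F p k d : F <= p < 2 * F -> H <= k < 2 * H ->
  d < 2 * H * F ->
  d <= 2 * H * p.+1 - k /\
  H * H * F < left_size (2 * H * p.+1) k - d <= 10 * (H * H * F).
Proof.
move=> /andP[Fp pF] /andP[Hk kH] dHF.
have dp : d < 2 * H * p by apply: leq_trans dHF _; rewrite leq_mul2l Fp orbT.
have P1 : 2 * H * p.+1 = 2 * H * p + 2 * H by rewrite mulnS addnC.
have kP : k <= 2 * H * p.+1 by lia.
split; first lia.
have Hp : H * H * F <= k * (2 * H * p) by rewrite -mulnA; apply: leq_mul => //; nia.
have up : k.+1 * (2 * H * p.+1) <= (2 * H) * (2 * H * (2 * F)).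
  by apply: leq_mul => //; rewrite leq_mul2l pF orbT.
rewrite /left_size; set m := 2 * H * p.+1 - k.
have mE : 2 * H * p.+1 = m + k by rewrite subnK.
have mp : 2 * H * p < m by lia.
have km : k * (2 * H * p) <= k * m by rewrite leq_mul2l (ltnW mp) orbT.
have b2 : 2 * k + 'C(k, 2) <= k * k + k.
  by case: (k) => [//|n]; rewrite bin2 /=; nia.
rewrite mE in up; apply/andP; split; first by lia.
have : 8 * (H * H * F) = 2 * H * (2 * H * (2 * F)) by lia.
nia.
Qed.

(** For H > 1 there are at least two runs, so that shortening the last one
    cannot change the order of magnitude; this is why a right piece with a
    single run is not shortened but treated as a word a b^n. *)
Lemma right_size_range H F p k d : 1 < H -> F <= p < 2 * F -> H <= k < 2 * H ->
  d < 2 * H * F ->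
  d <= 2 * H * p + k /\
  H * H * F < right_size (2 * H * p) k - d <= 10 * (H * H * F).
Proof.
move=> H1 /andP[Fp pF] /andP[Hk kH] dHF.
have dp : d < 2 * H * p by apply: leq_trans dHF _; rewrite leq_mul2l Fp orbT.
split; first lia.
rewrite /right_size; case: k kH Hk => [|k] kH Hk; first by lia.
rewrite [k.+1.-1]/=; set P := 2 * H * p in dp *.
have lo : H * H * F <= k * P.
  have : H * H * F <= H * H * p by rewrite leq_mul2l Fp orbT.
  have : H * P <= k * 2 * P by rewrite leq_mul2r; apply/orP; right; lia.
  by rewrite /P; lia.
have up : k.+1 * (P + 2 * H) <= (2 * H) * (2 * H * (2 * F)).
  by apply: leq_mul; [exact: ltnW|rewrite /P addnC -mulnS leq_mul2l pF orbT].
have b2 : 'C(k, 2) * 2 <= k * k by rewrite bin2; nia.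
apply/andP; split; first by lia.
have : 8 * (H * H * F) = 2 * H * (2 * H * (2 * F)) by lia.
have : k.+1 * k.+2 <= k.+1 * (2 * H) by rewrite leq_mul2l; apply/orP; right; lia.
nia.
Qed.

(** * Six factors suffice *)

Section Pieces.
Variables (T : eqType) (a b : T).
Implicit Types (w : seq T).
Local Notation climb := (climb a b).
Local Notation ladder := (ladder a b).

Definition left_piece m k d := nseq (m - d) b ++ climb m.+1 k.
Definition right_piece P k d := climb P.+1 k.-1 ++ a :: nseq (P + k - d) b.

Lemma size_left_piece P k d : d <= P - k ->
  size (left_piece (P - k) k d) = left_size P k - d.
Proof. by move=> dm; rewrite size_cat size_nseq size_climb /left_size addnBAC. Qed.

Lemma size_right_piece P k d : d <= P + k ->
  size (right_piece P k d) = right_size P k - d.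
Proof.
move=> dm; rewrite size_cat /= size_nseq size_climb /right_size -subSn //.
by rewrite addnBA // ltnW.
Qed.

(** The left pieces ending at P = 2^(h+1) (p + 1), with the removed part d
    making the length congruent to the stamp. The offset p + 1 ensures that
    the first run exceeds 2^(h+1) p and hence has enough letters to remove. *)
Definition left_lang c w := exists h p k d,
  [/\ [/\ 0 < p, 2 ^ h <= k < 2 ^ h.+1 & d < 2 ^ (h.+1 + trunc_log 2 p)],
   trunc_log 2 p = c %[mod 4],
   size w = 2 ^ h * p.*2.+1 %[mod 2 ^ (h.+1 + trunc_log 2 p)] &
   w = left_piece (2 ^ h.+1 * p.+1 - k) k d].

(** The right pieces starting after P = 2^(h+1) p, with k > 1 runs. *)
Definition right_lang c w := exists h p k d,
  [/\ [/\ 0 < p, 0 < h, 2 ^ h <= k < 2 ^ h.+1 & d < 2 ^ (h.+1 + trunc_log 2 p)],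
   trunc_log 2 p = c %[mod 4],
   size w = 2 ^ h * p.*2.+1 %[mod 2 ^ (h.+1 + trunc_log 2 p)] &
   w = right_piece (2 ^ h.+1 * p) k d].

(** The case p = 0 of the left pieces: then P is itself a power of 2, the
    first run may be too short to reach the residue of a stamp, and the length
    alone is enough to know the word. *)
Definition base_lang w := exists h k,
  2 ^ h <= k < 2 ^ h.+1 /\ w = left_piece (2 ^ h.+1 - k) k 0.

Lemma left_piece_range h p k d : 0 < p -> 2 ^ h <= k < 2 ^ h.+1 ->
  d < 2 ^ (h.+1 + trunc_log 2 p) ->
  d <= 2 ^ h.+1 * p.+1 - k /\
  4 ^ h * 2 ^ trunc_log 2 p < left_size (2 ^ h.+1 * p.+1) k - d
    <= 10 * (4 ^ h * 2 ^ trunc_log 2 p).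
Proof.
move=> p0; have := trunc_log_bounds (isT : 1 < 2) p0 => /=.
by rewrite (expnMn 2 2) expnD !expnS; exact: left_size_range.
Qed.

Lemma right_piece_range h p k d : 0 < p -> 0 < h -> 2 ^ h <= k < 2 ^ h.+1 ->
  d < 2 ^ (h.+1 + trunc_log 2 p) ->
  d <= 2 ^ h.+1 * p + k /\
  4 ^ h * 2 ^ trunc_log 2 p < right_size (2 ^ h.+1 * p) k - d
    <= 10 * (4 ^ h * 2 ^ trunc_log 2 p).
Proof.
move=> p0 h0; have := trunc_log_bounds (isT : 1 < 2) p0 => /=.
rewrite (expnMn 2 2) expnD !expnS; apply: right_size_range.
by rewrite -[1](expn0 2) ltn_exp2l.
Qed.

Lemma sub_window L d M : d <= L -> d < M -> L - d <= L < L - d + M.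
Proof. by lia. Qed.

Lemma sub_inj L d d' : d <= L -> d' <= L -> L - d = L - d' -> d = d'.
Proof. by lia. Qed.

Lemma thin_left c : thin (left_lang c).
Proof.
move=> w w' [h [p [k [d [[p0 hk dM] ec sw ew]]]]].
move=> [h' [p' [k' [d' [[p'0 hk' dM'] ec' sw' ew']]]]] es.
have [dm rg] := left_piece_range p0 hk dM.
have [dm' rg'] := left_piece_range p'0 hk' dM'.
have szE := size_left_piece dm; rewrite -ew in szE.
have szE' := size_left_piece dm'; rewrite -ew' -es in szE'.
rewrite -szE in rg; rewrite -szE' in rg'; rewrite -es in sw'.
have dl := leq_trans dm (leq_addr _ _ : _ <= left_size _ k).
have dl' := leq_trans dm' (leq_addr _ _ : _ <= left_size _ k').
have [||| eh ep ek] := stamp_inj left_size_gap (N := size w)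
  (h := h) (p := p) (k := k) (h' := h') (p' := p') (k' := k').
- by split=> //; rewrite szE; exact: sub_window.
- by split=> //; rewrite szE'; exact: sub_window.
- by rewrite ec ec'.
subst h' p' k'; rewrite ew ew'; congr left_piece.
by apply: sub_inj dl dl' _; rewrite -szE -szE'.
Qed.

Lemma thin_right c : thin (right_lang c).
Proof.
move=> w w' [h [p [k [d [[p0 h0 hk dM] ec sw ew]]]]].
move=> [h' [p' [k' [d' [[p'0 h'0 hk' dM'] ec' sw' ew']]]]] es.
have [dm rg] := right_piece_range p0 h0 hk dM.
have [dm' rg'] := right_piece_range p'0 h'0 hk' dM'.
have szE := size_right_piece dm; rewrite -ew in szE.
have szE' := size_right_piece dm'; rewrite -ew' -es in szE'.
rewrite -szE in rg; rewrite -szE' in rg'; rewrite -es in sw'.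
have dl := leq_trans dm (leq_trans (leqnSn _) (leq_addl _ _ : _ <= right_size _ k)).
have dl' := leq_trans dm' (leq_trans (leqnSn _) (leq_addl _ _ : _ <= right_size _ k')).
have [||| eh ep ek] := stamp_inj right_size_gap (N := size w)
  (h := h) (p := p) (k := k) (h' := h') (p' := p') (k' := k').
- by split=> //; rewrite szE; exact: sub_window.
- by split=> //; rewrite szE'; exact: sub_window.
- by rewrite ec ec'.
subst h' p' k'; rewrite ew ew'; congr right_piece.
by apply: sub_inj dl dl' _; rewrite -szE -szE'.
Qed.

Lemma left_size_mono P k k' : 0 < k < k' -> k' <= P -> left_size P k + 1 <= left_size P k'.
Proof.
by move=> kk; apply: step_gap kk => i /andP[_ iP]; rewrite left_sizeS ?leq_add2l ?subn_gt0.
Qed.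

(** These ranges are disjoint for H running through the powers of 2. *)
Lemma base_size_range H k : 0 < H -> H <= k < 2 * H ->
  H * H + 3 * H <= left_size (2 * H) k < 2 * (H * H) + 3 * H.
Proof.
move=> H0 /andP[Hk kH]; apply/andP; split.
  apply: (@leq_trans (left_size (2 * H) H)).
    by rewrite /left_size mul2n -addnn addnK !mulnS; lia.
  move: Hk; rewrite leq_eqVlt => /orP[/eqP <- //|Hk].
  apply: leq_trans (leq_addr 1 _) (left_size_mono _ (ltnW kH)).
  by rewrite H0.
rewrite -addn1; apply: leq_trans (left_size_mono _ (leqnn (2 * H))) _.
  by rewrite kH (leq_trans H0 Hk).
by rewrite /left_size subnn mul2n bin2 -mul2n; nia.
Qed.

(** The power of 2 is known from the order of magnitude of the length, and for
    fixed P the length increases with k. *)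
Lemma thin_base : thin base_lang.
Proof.
move=> w w' [h [k [hk ew]]] [h' [k' [hk' ew']]] es.
have szE := @size_left_piece (2 ^ h.+1) k 0 (leq0n _); rewrite -ew subn0 in szE.
have szE' := @size_left_piece (2 ^ h'.+1) k' 0 (leq0n _).
rewrite -ew' subn0 -es szE in szE'.
have eh : h = h'.
  have E i : 0 < 2 ^ i by rewrite expn_gt0.
  have := base_size_range (E h); rewrite -expnS => /(_ _ hk).
  have := base_size_range (E h'); rewrite -expnS => /(_ _ hk'); rewrite -szE'.
  have lt i j : i < j -> 2 * (2 ^ i * 2 ^ i) + 3 * 2 ^ i <= 2 ^ j * 2 ^ j + 3 * 2 ^ j.
    move=> ij; have : 2 ^ i.+1 <= 2 ^ j by rewrite leq_exp2l.
    by rewrite expnS; move: (2 ^ i) (2 ^ j) => A B AB; nia.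
  move=> /andP[l' u'] /andP[l u]; case: (ltngtP h h') => // /lt lh.
    by have := leq_trans u (leq_trans lh l'); rewrite ltnn.
  by have := leq_trans u' (leq_trans lh l); rewrite ltnn.
subst h'; rewrite ew ew'; suff -> : k = k' by [].
have k0 : 0 < k by case/andP: hk => + _; apply: leq_trans; rewrite expn_gt0.
have k'0 : 0 < k' by case/andP: hk' => + _; apply: leq_trans; rewrite expn_gt0.
case/andP: hk => _ /ltnW hk; case/andP: hk' => _ /ltnW hk'.
case: (ltngtP k k') => // kk.
  by have := @left_size_mono _ k k' _ hk'; rewrite k0 kk szE' => /(_ isT); rewrite addn1 ltnn.
by have := @left_size_mono _ k' k _ hk; rewrite k'0 kk szE' => /(_ isT); rewrite addn1 ltnn.
Qed.

(** Twelve thin languages; the indices 4 to 7 and 8 to 11 distinguish the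
    logarithm of p modulo 4. *)
Definition piece c w : Prop :=
  match c with
  | 0 => exists n, w = nseq n b
  | 1 => exists n, w = rcons (nseq n b) a
  | 2 => exists n, w = a :: nseq n b
  | 3 => base_lang w
  | _ => if c < 8 then left_lang c w else right_lang c w
  end.

Lemma thin_piece c : thin (piece c).
Proof.
case: c => [|[|[|[|c]]]] w w' /=.
- by move=> [n ->] [m ->]; rewrite !size_nseq => ->.
- by move=> [n ->] [m ->]; rewrite !size_rcons !size_nseq => -[->].
- by move=> [n ->] [m ->] /=; rewrite !size_nseq => -[->].
- exact: thin_base.
- by case: ifP => _; [exact: thin_left|exact: thin_right].
Qed.

Definition pieces w := exists2 c, c < 12 & piece c w.

(** If k is smaller than a power of 2 dividing P, then so is the least power
    of 2 above k. *)
Lemma dyadic_block e k P : 0 < k < 2 ^ e -> 2 ^ e %| P ->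
  exists2 h, 2 ^ h <= k < 2 ^ h.+1 & 2 ^ h.+1 %| P.
Proof.
move=> /andP[k0 ke] dP; have hk := trunc_log_bounds (isT : 1 < 2) k0.
exists (trunc_log 2 k) => //; apply: dvdn_trans dP; apply: dvdn_exp2l.
by rewrite -(ltn_exp2l _ _ (isT : 1 < 2)); case/andP: hk => /leq_ltn_trans ->.
Qed.

Lemma left_piece_mem e k P : 0 < k < 2 ^ e -> 2 ^ e %| P -> k < P ->
  exists2 d, d <= P - k & pieces (left_piece (P - k) k d).
Proof.
move=> ke /(dyadic_block ke) [h hk /dvdnP[[|p] ->]]; first by rewrite mul0n.
rewrite mulnC => _; case: (posnP p) => [->|p0].
  by exists 0 => //; exists 3 => //; exists h, k; rewrite muln1.
have M0 : 0 < 2 ^ (h.+1 + trunc_log 2 p) by rewrite expn_gt0.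
have [d dM dE] := shift_residue (left_size (2 ^ h.+1 * p.+1) k) (2 ^ h * p.*2.+1) M0.
have [dm _] := left_piece_range p0 hk dM.
exists d => //; exists (4 + trunc_log 2 p %% 4).
  by have := ltn_pmod (trunc_log 2 p) (isT : 0 < 4); lia.
rewrite /piece addSn ifT; last by have := ltn_pmod (trunc_log 2 p) (isT : 0 < 4); lia.
exists h, p, k, d; split=> //; first by rewrite -addSn modnDl modn_mod.
by rewrite size_left_piece //; apply: dE; apply: leq_trans dm (leq_addr _ _).
Qed.

Lemma right_piece_mem e k P : 0 < k < 2 ^ e -> 2 ^ e %| P -> 0 < P ->
  exists2 d, d <= P + k & pieces (right_piece P k d).
Proof.
move=> ke /(dyadic_block ke) [h hk /dvdnP[p ->]].
rewrite muln_gt0 => /andP[p0 _]; rewrite mulnC; case: (posnP h) => [h0|h0].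
  (* Here k = 1 and the piece is the word a b^(P + 1). *)
  exists 0 => //; exists 2 => //; exists (2 ^ h.+1 * p + k); rewrite /right_piece subn0.
  by move: hk; rewrite h0; case: k {ke} => [|[|k]].
have M0 : 0 < 2 ^ (h.+1 + trunc_log 2 p) by rewrite expn_gt0.
have [d dM dE] := shift_residue (right_size (2 ^ h.+1 * p) k) (2 ^ h * p.*2.+1) M0.
have [dm _] := right_piece_range p0 h0 hk dM.
exists d => //; exists (8 + trunc_log 2 p %% 4).
  by have := ltn_pmod (trunc_log 2 p) (isT : 0 < 4); lia.
exists h, p, k, d; split=> //; first by exact: esym (etrans (modnMDl 2 _ 4) (modn_mod _ _)).
rewrite size_right_piece //; apply: dE; apply: leq_trans dm _.
exact: leq_trans (leqnSn _) (leq_addl _ _).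
Qed.

Lemma pieces_b n : pieces (nseq n b).
Proof. by exists 0 => //; exists n. Qed.

Lemma pieces_ba n : pieces (rcons (nseq n b) a).
Proof. by exists 1 => //; exists n. Qed.

Lemma pieces_ab n : pieces (a :: nseq n b).
Proof. by exists 2 => //; exists n. Qed.

Lemma left_part m e P : 0 < m <= P -> P < m + 2 ^ e -> 2 ^ e %| P ->
  exists d x, pieces x /\ climb m (P - m).+1 = a :: nseq d b ++ x.
Proof.
move=> /andP[m0 mP] Pe dP.
suff [d dm px] : exists2 d, d <= m & pieces (left_piece m (P - m) d).
  exists d, (left_piece m (P - m) d); split=> //.
  by rewrite climbS /left_piece catA -nseqD subnKC.
case: (posnP (P - m)) => [->|k0].
  exists 0 => //; rewrite /left_piece subn0 cats0; exact: pieces_b.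
have ke : 0 < P - m < 2 ^ e by rewrite k0 ltn_subLR.
have [|d] := left_piece_mem ke dP; first lia.
by rewrite subKn //; exists d.
Qed.

Lemma right_part e P M : 0 < P <= M -> M < P + 2 ^ e -> 2 ^ e %| P ->
  exists d x, pieces x /\ climb P.+1 (M - P) = x ++ nseq d b.
Proof.
move=> /andP[P0 PM] Me dP; case: (posnP (M - P)) => [->|k0].
  by exists 0, [::]; split=> //; exact: (pieces_b 0).
have ke : 0 < M - P < 2 ^ e by rewrite k0 ltn_subLR.
have [d dm px] := right_piece_mem ke dP P0.
exists d, (right_piece P (M - P) d); split=> //.
rewrite /right_piece -catA /= -nseqD subnK // -[X in climb _ X](prednK k0) climbSr.
by congr (_ ++ _ :: nseq _ b); lia.
Qed.

Lemma ladder_six i m l j : 0 < m -> exists ws : seq (seq T),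
  [/\ size ws = 6, forall w, w \in ws -> pieces w & ladder i m l j = flatten ws].
Proof.
move=> m0; have p0 := pieces_b 0.
have memP ws : foldr (fun w => and (pieces w)) True ws -> forall w, w \in ws -> pieces w.
  elim: ws => //= w ws IH [pw /IH pws] w'.
  by rewrite inE => /predU1P[->|/pws].
case: l => [|l].
  exists [:: rcons (nseq i b) a; nseq j b; [::]; [::]; [::]; [::]].
  split=> //; last by rewrite /ladder /= cats0 cat_rcons.
  by apply: memP; do !split=> //; [exact: pieces_ba|exact: pieces_b].
(* The full runs are b^m, ..., b^(m + l), cut after the run b^P. *)
have [|e [P [dP /andP[mP PM] Pe Me]]] := @midpoint m (m + l); first by rewrite m0 leq_addr.
have P0 : 0 < P by apply: leq_trans mP.
have [|d [x [px ex]]] := @left_part m e P _ Pe dP; first by rewrite m0.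
have [|d' [y [py ey]]] := @right_part e P (m + l) _ Me dP; first by rewrite P0.
exists [:: rcons (nseq i b) a; nseq d b; x; y; nseq d' b; a :: nseq j b].
split=> //.
  by apply: memP; do !split=> //;
    [exact: pieces_ba|exact: pieces_b|exact: pieces_b|exact: pieces_ab].
have -> : l.+1 = (P - m).+1 + (m + l - P) by lia.
rewrite /ladder climbD addnS subnKC // ex ey /= cats0 cat_rcons.
by rewrite /= -!catA.
Qed.

End Pieces.

Lemma pieces_letters (T : eqType) (a b : T) w :
  pieces a b w -> all (mem [:: a; b]) w.
Proof.
have an n : all (mem [:: a; b]) (nseq n b).
  by rewrite all_nseq /= !inE eqxx !orbT.
have aa : a \in [:: a; b] by rewrite inE eqxx.
have ac m l : all (mem [:: a; b]) (climb a b m l).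
  by elim: l m => // l IH m; rewrite climbS /= aa all_cat an IH.
have al m k d : all (mem [:: a; b]) (left_piece a b m k d) by rewrite all_cat an ac.
have ar m k d : all (mem [:: a; b]) (right_piece a b m k d) by rewrite all_cat /= aa an ac.
case=> [[|[|[|[|c]]]] _ /=].
- by case=> n ->; apply: an.
- by case=> n ->; rewrite all_rcons an andbT; apply: aa.
- by case=> n ->; rewrite [all _ _]/= an andbT; apply: aa.
- by case=> h [k [_ ->]]; apply: al.
- by case: ifP => _ [h [p [k [d [_ _ _ ->]]]]]; [apply: al|apply: ar].
Qed.

Lemma pieces_lang_class (R : realType) (T : choiceType) (a b : T) :
  lang_class (0 : R)%R [set w | pieces a b w].
Proof.
split.
  exists [set a; b]; split; first exact: finite_set2.
    by exists a; left.
  move=> w /pieces_letters/allP al c /al; rewrite !inE.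
  by move=> /orP[/eqP->|/eqP->]; [left|right].
apply/eqO_exP; exists (12%:R)%R => //; exists 0 => // n _.
rewrite /= powRr0 normr1 mulr1 ger0_norm ?ler0n // ler_nat.
exact: complexity_thin_cover (@thin_piece _ a b).
Qed.

Lemma fac_pow6 (T : choiceType) (a b : T) :
  Fac (word_u a b) `<=` lang_pow [set w | pieces a b w] 6.
Proof.
move=> w /fac_shape [[i ->]|[i [m [l [j [m0 ->]]]]]].
  exists [tuple of nseq i b :: nseq 5 [::]]; split; last by rewrite /= cats0.
  move=> t; have := mem_tnth t [tuple of nseq i b :: nseq 5 [::]].
  rewrite inE => /predU1P[->|/nseqP[-> _]]; [exact: pieces_b|exact: (pieces_b a b 0)].
have [ws [s6 mem e]] := ladder_six a b i l j m0.
exists (Tuple (introT eqP s6)); split=> // t.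
by apply: mem; apply: (mem_tnth t (Tuple (introT eqP s6))).
Qed.

(** * The theorem *)

Local Open Scope ring_scope.

Theorem theorem5p4 (R : realType) (T : choiceType) (a b : T) (hab : a != b) :
  (fun n : nat => (complexity (Fac (word_u a b)) n)%:R : R^o) =Theta_\oo
     (fun n : nat => n%:R ^+ 2 : R^o)
  /\ (4%:E <= alpha_dim (0 : R) (word_u a b) <= 6%:E)%E.
Proof.
split.
  rewrite eqThetaE; apply/asboolP; exists (49%:R^-1, 4%:R) => /=.
    by rewrite invr_gt0 !ltr0n.
  exists 4%N => // n /= n4.
  rewrite !ger0_norm ?ler0n ?exprn_ge0 // ler_pdivrMl ?ltr0n //.
  rewrite -natrX -!natrM !ler_nat; split; first exact: complexity_u_ge.
  by apply: leq_trans (complexity_u_le _ _ _) _; nia.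
apply/andP; split.
  apply: le_ereal_inf_tmp => _ [k [k1 [S Scl sub]] <-].
  rewrite lee_fin ler_nat leqNgt; apply/negP => k4.
  exact: no_cube_cover hab Scl k4 sub.
apply: ereal_inf_lbound; exists 6%N => //; split=> //.
by exists [set w | pieces a b w]; [exact: pieces_lang_class|exact: fac_pow6].
Qed.
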